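(* Let $Z$ be the Schreier graph of the free group $\mathbb{F}_2=\langle a,b\rangle$ obtained from its right Cayley graph by replacing the branch containing $a$ with an infinite tail on which $b$ acts trivially. Define $\varphi:Z\to\mathbb{R}$ by $\varphi(x)=1$ if $x$ is on the tail and $\varphi(x)=3^{-|x|}$ if $x$ is outside the tail at distance $|x|$ from $e$, and define $f:\mathcal{P}_f(Z)\to\mathbb{R}$ by $f(E)=\min_{x\in E}\varphi(x)$ for $E\ne\varnothing$ and $f(\varnothing)=1$. Then there is no sequence $E_n\in\mathcal{P}_f(Z)$ such that for every word $g$ in the letters $a,a^{-1},b,b^{-1}$ and the switch $\sigma$ the sequence $\frac{f(E_ng)}{f(E_n)}$ converges to $1$.
   Context: Explicitly, the vertex set of $Z$ consists of all reduced words in $a^{\pm1},b^{\pm1}$ that do not begin with the letter $a$ (including the empty word $e$), together with tail points $t_1,t_2,\dots$. The right action of $\mathbb{F}_2$ on $Z$: for a reduced word $x$ in $Z$ and a letter $s\in\{a^{\pm1},b^{\pm1}\}$, $x\cdot s$ is the reduced product $xs$, except that $e\cdot a=t_1$; on the tail, $t_i\cdot a=t_{i+1}$, $t_1\cdot a^{-1}=e$, $t_{i+1}\cdot a^{-1}=t_i$, and $t_i\cdot b^{\pm1}=t_i$. $\mathcal{P}_f(Z)$ is the set of finite subsets of $Z$. A letter $s\in\{a^{\pm1},b^{\pm1}\}$ acts on $E\in\mathcal{P}_f(Z)$ by $Es=\{x\cdot s: x\in E\}$, and the switch acts by $E\sigma=E\,\Delta\,\{e\}$; words act by applying their letters from left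 to right. *)

(* Defs.v *)
From HB Require Import structures.
From mathcomp Require Import all_boot all_order all_algebra finmap.
From mathcomp Require Import all_classical all_reals all_analysis.

Set Implicit Arguments.
Unset Strict Implicit.
Unset Printing Implicit Defensive.

Import Order.TTheory GRing.Theory Num.Theory.
Import numFieldNormedType.Exports.

Local Open Scope ring_scope.

(* The letters a, a^-1, b, b^-1. *)
Inductive letter := La | LaV | Lb | LbV.

Definition letter_code (s : letter) : bool * bool :=
  match s with
  | La => (false, false) | LaV => (false, true)
  | Lb => (true, false) | LbV => (true, true)
  end.

Definition letter_decode (p : bool * bool) : letter :=
  match p with
  | (false, false) => La | (false, true) => LaV
  | (true, false) => Lb | (true, true) => LbV
  end.

Lemma letter_codeK : cancel letter_code letter_decode.
Proof. by case. Qed.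

HB.instance Definition _ := Finite.copy letter (can_type letter_codeK).

Definition linv (s : letter) : letter :=
  match s with La => LaV | LaV => La | Lb => LbV | LbV => Lb end.

Definition reduced (w : seq letter) : bool := sorted (fun s t => t != linv s) w.

Definition off_tail (w : seq letter) : bool :=
  reduced w && (ohead w != Some La).

Record word := Word { word_val :> seq letter; word_valP : off_tail word_val }.

HB.instance Definition _ := [isSub for word_val].
HB.instance Definition _ := [Countable of word by <:].

(* The vertex set of Z: [inl w] is the vertex of the reduced word [w], and
   [inr i] is the tail point t_(i+1). *)
Definition vertex := (word + nat)%type.

Definition base : vertex := inl (@Word [::] isT).

(* The reduced product w s of a reduced word and a letter. *)
Definition redmul (w : seq letter) (s : letter) : seq letter :=
  if w is x :: w' then
    if last x w' == linv s then belast x w' else rcons w s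
  else [:: s].

(* [insubd] never takes its default value here, see [redmul_off_tail]. *)
Definition act_letter (x : vertex) (s : letter) : vertex :=
  match x with
  | inl w =>
      if (word_val w == [::]) && (s == La) then inr 0%N
      else inl (insubd w (redmul w s))
  | inr i =>
      match s with
      | La => inr i.+1
      | LaV => if i is j.+1 then inr j else base
      | Lb | LbV => inr i
      end
  end.

Definition act_letters (x : vertex) (u : seq letter) : vertex := foldl act_letter x u.

Lemma linvK : involutive linv. Proof. by case. Qed.

Lemma redmul_off_tail (w : seq letter) (s : letter) :
  off_tail w -> ~~ ((w == [::]) && (s == La)) -> off_tail (redmul w s).
Proof.
rewrite /off_tail /reduced; case: w => [|x w] /=; first by move=> _ /eqP; case: s.
case/andP=> pw hx _; case: ifP => [_|/negbT ns] /=.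
  case/lastP: w pw => [//|w y]; rewrite belast_rcons rcons_path.
  by case/andP=> /= ->.
rewrite rcons_path pw hx /= andbT; apply: contra ns => /eqP ->.
by rewrite linvK.
Qed.

Lemma act_letters_word (u : seq letter) (w : word) :
  off_tail (w ++ u) -> exists2 v : word, word_val v = w ++ u &
  act_letters (inl w) u = inl v.
Proof.
elim: u w => [|s u IHu] w; first by rewrite cats0; exists w.
rewrite -cat_rcons => ok.
have ok1 : off_tail (rcons w s).
  case/andP: ok => r h; apply/andP; split.
    by move: r; rewrite /reduced; case: (word_val w) => //= x p; rewrite cat_path => /andP[].
  by case: (word_val w) h.
have e1 : redmul w s = rcons w s.
  rewrite /redmul; case/andP: (ok1) => + _; rewrite /reduced.
  case: (word_val w) => //= x p; rewrite rcons_path => /andP[_ h].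
  by case: ifP h => // /eqP ->; rewrite linvK eqxx.
have [v ve vE] := IHu (Word ok1) ok; exists v => //=.
rewrite -vE /act_letters /=; case: ifP => [|_].
  by case/andP=> /eqP w0 /eqP sa; exfalso; have := ok1; rewrite w0 sa => /andP[].
congr (foldl _ (inl _) _); apply: val_inj.
by rewrite /= val_insubd e1 ok1.
Qed.

Lemma base_connected (x : vertex) :
  exists n, [exists u : n.-tuple letter, act_letters base u == x].
Proof.
case: x => [w|i].
  have [v ve vE] := @act_letters_word w (Word (isT : off_tail [::])) (word_valP w).
  exists (size w); apply/existsP; exists (in_tuple w); rewrite /base vE.
  by apply/eqP; congr inl; apply: val_inj.
exists i.+1; apply/existsP; exists (nseq_tuple i.+1 La) => /=.
rewrite /act_letters /=; apply/eqP.
have E k j : foldl act_letter (inr j) (nseq k La) = inr (k + j)%N.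
  by elim: k j => //= k IHk j; rewrite IHk addnS.
by rewrite E addn0.
Qed.

(* Graph distance to [base]: the least length of an edge path from [base]. *)
Definition base_dist (x : vertex) : nat := ex_minn (base_connected x).

Lemma dist_word (w : word) : base_dist (inl w) = size w.
Proof.
rewrite /base_dist; case: ex_minnP => n /existsP[u /eqP uE] nmin; apply/eqP.
rewrite eqn_leq; apply/andP; split.
  apply: nmin; apply/existsP; exists (in_tuple w).
  have [v ve vE] := @act_letters_word w (Word (isT : off_tail [::])) (word_valP w).
  by rewrite /base vE; apply/eqP; congr inl; apply: val_inj.
pose len (x : vertex) := if x is inl w then size w else 0%N.
have lenS x s : (len (act_letter x s) <= (len x).+1)%N.
  case: x => [v|[|i]]; [|by case: s|by case: s].
  rewrite /=; case: ifP => //= _; rewrite val_insubd; case: ifP => // _.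
  rewrite /redmul; case: (word_val v) => //= x p.
  by case: ifP; rewrite /= ?size_rcons ?size_belast // ltnW.
have lenU t x : (len (act_letters x t) <= len x + size t)%N.
  elim: t x => [|s t IHt] x; first by rewrite addn0.
  by apply: leq_trans (IHt _) _; rewrite /= addnS -addSn leq_add2r.
by have := lenU u base; rewrite uE size_tuple.
Qed.

Inductive sletter := Letter of letter | Switch.

Local Open Scope fset_scope.

Definition act_set (E : {fset vertex}) (s : sletter) : {fset vertex} :=
  match s with
  | Letter l => [fset act_letter x l | x in E]
  | Switch => (E `\` [fset base]) `|` ([fset base] `\` E)
  end.

Definition act_sword (E : {fset vertex}) (g : seq sletter) : {fset vertex} :=
  foldl act_set E g.

Definition phi (R : realType) (x : vertex) : R :=
  match x with
  | inr _ => 1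
  | inl _ => 3 ^- base_dist x
  end.

(* The minimum of a nonempty finite set is computed along its enumeration. *)
Definition fmin (R : realType) (E : {fset vertex}) : R :=
  if enum_fset E is x :: s then \big[Num.min/phi R x]_(y <- s) phi R y else 1.

Lemma fmin_le (R : realType) (E : {fset vertex}) (x : vertex) :
  x \in E -> fmin R E <= phi R x.
Proof.
rewrite /fmin => xE; have: x \in enum_fset E by [].
case: (enum_fset E) => // y s; rewrite inE => /orP[/eqP ->|xs].
  by elim/big_rec: _ => // i z _ h; rewrite ge_min h orbT.
elim: s xs => // z s IHs; rewrite inE big_cons ge_min.
by case/orP=> [/eqP ->|/IHs ->]; rewrite ?lexx ?orbT.
Qed.

Lemma fmin_attained (R : realType) (E : {fset vertex}) :
  E != fset0 -> exists2 x, x \in E & fmin R E = phi R x.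
Proof.
move=> /fset0Pn[x0 x0E]; rewrite /fmin.
have: x0 \in enum_fset E by []; have sE: {subset enum_fset E <= E} by [].
case: (enum_fset E) sE => // y s sE _.
suff [x xs ->] : exists2 x, x \in y :: s &
    \big[Num.min/phi R y]_(z <- s) phi R z = phi R x by exists x => //; exact: sE.
elim: {sE} s => [|z s [x xs IHs]]; first by exists y; rewrite ?big_nil ?mem_head.
rewrite big_cons IHs; case: leP => _; first by exists z; rewrite ?inE ?eqxx ?orbT.
by exists x => //; move: xs; rewrite !inE => /orP[->|->]; rewrite ?orbT.
Qed.

(* Main.v *)
(* Every vertex outside the tail can be pushed one step further from [base] by
   [b] or [b^-1], which divides [phi] by 3. A minimizer of [phi] on [E] outside
   the tail thus gives [fmin (E s) <= fmin E / 3] for [s = b] or [s = b^-1]. If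
   there is none then [fmin E = 1], and [b] (when [base] lies in [E]) or [sigma b]
   (otherwise) creates the vertex [b], where [phi] is 1/3. So for every [E] one of
   three fixed words divides [fmin] by at least 3. *)
Require Import Defs.
From HB Require Import structures.
From mathcomp Require Import all_boot all_order all_algebra finmap.
From mathcomp Require Import all_classical all_reals all_analysis.

Import Order.TTheory GRing.Theory Num.Theory.
Import numFieldNormedType.Exports.

Local Open Scope classical_set_scope.
Local Open Scope ring_scope.

Lemma phi_gt0 (R : realType) (x : vertex) : 0 < phi R x.
Proof. by case: x => [w|i] //=; rewrite invr_gt0 exprn_gt0. Qed.

Lemma fmin0 (R : realType) : fmin R fset0 = 1.
Proof. by rewrite /fmin (size0nil (cardfs0 vertex)). Qed.

Lemma fmin_gt0 (R : realType) (E : {fset vertex}) : 0 < fmin R E.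
Proof.
have [->|/(fmin_attained R)[x _ ->]] := eqVneq E fset0; last exact: phi_gt0.
by rewrite fmin0.
Qed.

(** Nothing cancels when [s] is appended, so the word length, which is the distance to [base], grows
    by one. *)
Lemma phi_act_rcons (R : realType) (w : word) (s : letter) :
  off_tail (rcons w s) -> phi R (act_letter (inl w) s) = 3^-1 * phi R (inl w).
Proof.
rewrite -cats1 => /act_letters_word[v vE]; rewrite /act_letters /= => ->.
by rewrite /phi !dist_word vE size_cat addn1 exprS invfM.
Qed.

(** The last letter of [w] cannot be inverse to both [Lb] and [LbV], and neither is the forbidden
    first letter [La]. *)
Lemma off_tail_rcons_b (w : word) :
  off_tail (rcons w Lb) || off_tail (rcons w LbV).
Proof.
case: w => [[|x p] /=] //; rewrite /off_tail /reduced /= !rcons_path.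
by case/andP=> -> ->; case: (last x p).
Qed.

Lemma fmin_act_letter_le (R : realType) (E : {fset vertex}) (x : vertex)
    (s : letter) : x \in E ->
  fmin R (act_sword E [:: Letter s]) <= phi R (act_letter x s).
Proof. by move=> xE; apply/fmin_le/imfsetP; exists x. Qed.

Lemma phi_base (R : realType) : phi R base = 1.
Proof. by rewrite /phi dist_word expr0 invr1. Qed.

Lemma fmin_contracted (R : realType) (E : {fset vertex}) :
  [\/ fmin R (act_sword E [:: Letter Lb]) <= 3^-1 * fmin R E,
      fmin R (act_sword E [:: Letter LbV]) <= 3^-1 * fmin R E |
      fmin R (act_sword E [:: Switch; Letter Lb]) <= 3^-1 * fmin R E].
Proof.
have phi_b : phi R (act_letter base Lb) = 3^-1.
  by rewrite phi_act_rcons // phi_base mulr1.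
have fminE1 : fmin R E = 1 ->
    fmin R (act_sword E [:: Letter Lb]) <= 3^-1 * fmin R E \/
    fmin R (act_sword E [:: Switch; Letter Lb]) <= 3^-1 * fmin R E.
  (* With 1/3 read as [phi] at the vertex b, it suffices that [base] lies in the set on which [Lb]
     acts. *)
  move=> ->; rewrite mulr1 -phi_b.
  have [baseE|baseNE] := boolP (base \in E); [left|right].
    exact: fmin_act_letter_le.
  apply: (@fmin_act_letter_le R (act_set E Switch)).
  by rewrite !inE eqxx baseNE orbT.
have [E0|/(fmin_attained R)[[w|i] xE fE]] := eqVneq E fset0.
- have /fminE1[?|?] : fmin R E = 1 by rewrite E0 fmin0.
    exact: Or31.
  exact: Or33.
- by case/orP: (off_tail_rcons_b w) => /(phi_act_rcons R) phiE;
     [apply: Or31|apply: Or32]; rewrite fE -phiE; exact: fmin_act_letter_le.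
(* The minimizer is a tail point, so [fE] computes to [fmin R E = 1]. *)
- by have /fminE1[?|?] := fE; [exact: Or31|exact: Or33].
Qed.

Theorem mainTheorem9 (R : realType) :
  ~ exists E : nat -> {fset vertex},
      forall g : seq sletter,
        (fun n => fmin R (act_sword (E n) g) / fmin R (E n)) @ \oo --> (1 : R).
Proof.
case=> E cvgE.
have ratio_gt g : \forall n \near \oo,
    3^-1 * fmin R (E n) < fmin R (act_sword (E n) g).
  have lt1 : 3^-1 < 1 :> R by rewrite invf_lt1 ?ltr1n.
  apply: filterS (cvgr_gt _ (cvgE g) _ lt1) => n.
  by rewrite ltr_pdivlMr ?fmin_gt0.
(* Only three words matter, so a single [n] satisfies all their strict bounds, against
   [fmin_contracted]. *)
have [n [[ltb ltbV] ltsb]] :=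
  filter_ex (filterI (filterI (ratio_gt [:: Letter Lb]) (ratio_gt [:: Letter LbV]))
    (ratio_gt [:: Switch; Letter Lb])).
by have [] := fmin_contracted R (E n); apply/negP; rewrite -ltNge.
Qed.
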